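(* Mumbling $H_\mu$ with unique mumbling and stuttering $H_\mu$ with unique stuttering (both with full basis) are expressively equivalent.
   Context: Fix a finite set $\mathit{AP}$. A trace is an infinite sequence $P_0m_0P_1m_1\dots$ with $P_i\subseteq\mathit{AP}$, $m_i\in\{\mathit{int},\mathit{call},\mathit{ret}\}$; $\mathit{tr}(i)=P_i$. Successor functions: $\mathit{succ}_\mathsf{g}(\mathit{tr},i)=i+1$; $\mathit{succ}_\mathsf{a}(\mathit{tr},i)=i+1$ if $m_i=\mathit{int}$, and if $m_i=\mathit{call}$ the least $j>i$ such that among $m_i,\dots,m_{j-1}$ the numbers of $\mathit{call}$ and $\mathit{ret}$ coincide (undefined if none), undefined if $m_i=\mathit{ret}$; $\mathit{succ}_\mathsf{c}(\mathit{tr},i)$ the largest $j<i$ with $m_j=\mathit{call}$ such that among $m_{j+1},\dots,m_{i-1}$ the numbers of $\mathit{call}$ and $\mathit{ret}$ coincide (undefined if none). Mumbling $H_\mu$: trace formulae $\delta ::= \mathit{ap}\mid Y\mid\delta\lor\delta\mid\lnot\delta\mid\bigcirc^\mathsf{f}\delta\mid\mu Y.\delta$ ($\mathsf{f}\in\{\mathsf{g},\mathsf{a},\mathsf{c}\}$); multitrace formulae $\psi ::= [\delta]_\pi\mid X\mid\psi\lor\psi\mid\lnot\psi\mid\bigcirc^\Delta\psi\mid\mu X.\psi$ with $\Delta$ mapping trace variables to trace formulae; hyperproperty formulae $\varphi ::= \exists\pi.\varphi\mid\forall\pi.\varphi\mid\psi$; fixpoint variables occur positively; closed = all variables bound. Trace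 semantics $\llbracket\delta\rrbracket^{\mathit{tr}}_{\mathcal{V}}\subseteq\mathbb{N}_0$: $\mathit{ap}\mapsto\{i\mid\mathit{ap}\in\mathit{tr}(i)\}$, $Y\mapsto\mathcal{V}(Y)$, union, complement, $\bigcirc^\mathsf{f}\delta\mapsto\{i\mid\mathit{succ}_\mathsf{f}(\mathit{tr},i)$ defined and in $\llbracket\delta\rrbracket\}$, $\mu Y.\delta\mapsto\bigcap\{I\mid\llbracket\delta\rrbracket_{\mathcal{V}[Y\mapsto I]}\subseteq I\}$. $\mathit{succ}_\delta(\mathit{tr},i)=\min\{j>i\mid j\in\llbracket\delta\rrbracket^{\mathit{tr}}\}$ if nonempty, else $i+1$; $\mathit{succ}_\Delta(\Pi,v)$ componentwise for a trace assignment $\Pi$ on $\pi_1,\dots,\pi_n$. $\llbracket\psi\rrbracket^\Pi_{\mathcal{W}}\subseteq\mathbb{N}_0^n$: $[\delta]_{\pi_j}\mapsto\{v\mid v_j\in\llbracket\delta\rrbracket^{\Pi(\pi_j)}\}$, $X\mapsto\mathcal{W}(X)$, Boolean as usual, $\bigcirc^\Delta\psi\mapsto\{v\mid\mathit{succ}_\Delta(\Pi,v)\in\llbracket\psi\rrbracket\}$, $\mu X$ least fixpoint. $\Pi\models_\mathcal{T}\exists\pi.\varphi$ iff some $\mathit{tr}\in\mathcal{T}$ gives $\Pi[\pi\mapsto\mathit{tr}]\models_\mathcal{T}\varphi$; $\forall$ for all; $\Pi\models_\mathcal{T}\psi$ iff $(0,\dots,0)\in\llbracket\psi\rrbracket^\Pi$.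 For closed $\varphi$ and a set of traces $\mathcal{T}$, $\mathcal{T}\models\varphi$ iff the empty assignment satisfies $\varphi$ over $\mathcal{T}$. Stuttering $H_\mu$ is identical except that multitrace next operators are $\bigcirc^\Gamma\psi$ with $\Gamma$ mapping each trace variable to a finite set of trace formulae; for a finite set $\gamma$, $\mathit{succ}_\gamma(\mathit{tr},i)=\min\{j>i\mid$ for some $\delta\in\gamma$: $i\in\llbracket\delta\rrbracket^{\mathit{tr}}\not\Leftrightarrow j\in\llbracket\delta\rrbracket^{\mathit{tr}}\}$ if nonempty, else $i+1$; $\mathit{succ}_\Gamma$ componentwise and $\llbracket\bigcirc^\Gamma\psi\rrbracket=\{v\mid\mathit{succ}_\Gamma(\Pi,v)\in\llbracket\psi\rrbracket\}$. Unique mumbling (stuttering): all multitrace next operators use the same $\Delta$ ($\Gamma$). Two logics are expressively equivalent if for every closed hyperproperty formula of either logic there is a closed formula of the other logic such that for all sets of traces $\mathcal{T}$, $\mathcal{T}$ satisfies the first iff it satisfies the second. *)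

(* Defs.v *)
From mathcomp Require Import all_boot.
From Stdlib Require List.
Set Implicit Arguments.
Unset Strict Implicit.
Unset Printing Implicit Defensive.

Inductive move := MInt | MCall | MRet.

Definition is_call (m : move) : bool := if m is MCall then true else false.
Definition is_ret (m : move) : bool := if m is MRet then true else false.

Inductive sfun := Fg | Fa | Fc.

Section Logic.
Variable AP : finType.

(* a trace P_0 m_0 P_1 m_1 ... *)
Record trace := Trace { tprops : nat -> {set AP}; tmoves : nat -> move }.

Definition ncalls (tr : trace) (i j : nat) : nat :=
  count (fun k => is_call (tmoves tr k)) (iota i (j - i)).
Definition nrets (tr : trace) (i j : nat) : nat :=
  count (fun k => is_ret (tmoves tr k)) (iota i (j - i)).
Definition balanced (tr : trace) (i j : nat) : Prop := ncalls tr i j = nrets tr i j.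

(* succ_rel f tr i j  <->  succ_f(tr, i) is defined and equals j *)
Definition succ_rel (f : sfun) (tr : trace) (i j : nat) : Prop :=
  match f with
  | Fg => j = i.+1
  | Fa =>
      match tmoves tr i with
      | MInt => j = i.+1
      | MCall => [/\ i < j, balanced tr i j &
                     forall k, i < k < j -> ~ balanced tr i k]
      | MRet => False
      end
  | Fc => [/\ j < i, tmoves tr j = MCall, balanced tr j.+1 i &
              forall k, j < k < i -> tmoves tr k = MCall -> ~ balanced tr k.+1 i]
  end.

Inductive tf :=
| TAp of AP
| TVar of nat
| TOr of tf & tf
| TNot of tf
| TNext of sfun & tf
| TMu of nat & tf.

Definition updV (V : nat -> nat -> Prop) (Y : nat) (I : nat -> Prop) :=
  fun Z => if Z == Y then I else V Z.

Fixpoint tsem (tr : trace) (V : nat -> nat -> Prop) (d : tf) : nat -> Prop :=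
  match d with
  | TAp a => fun i => a \in tprops tr i
  | TVar Y => V Y
  | TOr d1 d2 => fun i => tsem tr V d1 i \/ tsem tr V d2 i
  | TNot d1 => fun i => ~ tsem tr V d1 i
  | TNext f d1 => fun i => exists j, succ_rel f tr i j /\ tsem tr V d1 j
  | TMu Y d1 => fun i => forall I : nat -> Prop,
        (forall k, tsem tr (updV V Y I) d1 k -> I k) -> I i
  end.

Definition V0 : nat -> nat -> Prop := fun _ _ => False.

Fixpoint tpos (b : bool) (Y : nat) (d : tf) : bool :=
  match d with
  | TAp _ => true
  | TVar Z => b || (Z != Y)
  | TOr d1 d2 => tpos b Y d1 && tpos b Y d2
  | TNot d1 => tpos (~~ b) Y d1
  | TNext _ d1 => tpos b Y d1
  | TMu Z d1 => (Z == Y) || tpos b Y d1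
  end.

Fixpoint tok_in (bound : seq nat) (d : tf) : bool :=
  match d with
  | TAp _ => true
  | TVar Y => Y \in bound
  | TOr d1 d2 => tok_in bound d1 && tok_in bound d2
  | TNot d1 => tok_in bound d1
  | TNext _ d1 => tok_in bound d1
  | TMu Y d1 => tpos true Y d1 && tok_in (Y :: bound) d1
  end.
Definition tok (d : tf) : bool := tok_in [::] d.

(* multitrace formulae, parametrised by the annotation D of next operators
   (D = trace variable -> trace formula for mumbling,
    D = trace variable -> finite set of trace formulae for stuttering);
   trace variables are natural numbers *)
Inductive mf (D : Type) :=
| MAtom of tf & nat
| MVar of nat
| MOr of mf D & mf D
| MNot of mf D
| MNext of D & mf D
| MMu of nat & mf D.

Inductive hf (D : Type) :=
| HEx of nat & hf D
| HAll of nat & hf D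
| HM of mf D.

Arguments MAtom {D}. Arguments MVar {D}.

Section Sem.
Variable D : Type.
(* step Delta pi tr i j <-> the successor of position i on trace tr
   (bound to pi) under annotation Delta is j *)
Variable step : D -> nat -> trace -> nat -> nat -> Prop.

Definition nextvec (Dl : D) (Pi : nat -> option trace) (v w : nat -> nat) : Prop :=
  forall pi, match Pi pi with
             | Some tr => step Dl pi tr (v pi) (w pi)
             | None => w pi = (v pi).+1
             end.

Definition updW (W : nat -> (nat -> nat) -> Prop) (X : nat) (S : (nat -> nat) -> Prop) :=
  fun Z => if Z == X then S else W Z.

Fixpoint msem (Pi : nat -> option trace) (W : nat -> (nat -> nat) -> Prop)
  (p : mf D) : (nat -> nat) -> Prop :=
  match p with
  | MAtom d pi => fun v => match Pi pi with
                           | Some tr => tsem tr V0 d (v pi)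
                           | None => False
                           end
  | MVar X => W X
  | MOr p1 p2 => fun v => msem Pi W p1 v \/ msem Pi W p2 v
  | MNot p1 => fun v => ~ msem Pi W p1 v
  | MNext Dl p1 => fun v => exists w, nextvec Dl Pi v w /\ msem Pi W p1 w
  | MMu X p1 => fun v => forall S : (nat -> nat) -> Prop,
        (forall u, msem Pi (updW W X S) p1 u -> S u) -> S v
  end.

Definition W0 : nat -> (nat -> nat) -> Prop := fun _ _ => False.

Definition updPi (Pi : nat -> option trace) (pi : nat) (tr : trace) :=
  fun q => if q == pi then Some tr else Pi q.

Fixpoint hsem (T : trace -> Prop) (Pi : nat -> option trace) (f : hf D) : Prop :=
  match f with
  | HEx pi f1 => exists tr, T tr /\ hsem T (updPi Pi pi tr) f1
  | HAll pi f1 => forall tr, T tr -> hsem T (updPi Pi pi tr) f1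
  | HM p => msem Pi W0 p (fun _ => 0)
  end.

Definition models (T : trace -> Prop) (f : hf D) : Prop := hsem T (fun _ => None) f.

Fixpoint mpos (b : bool) (X : nat) (p : mf D) : bool :=
  match p with
  | MAtom _ _ => true
  | MVar Z => b || (Z != X)
  | MOr p1 p2 => mpos b X p1 && mpos b X p2
  | MNot p1 => mpos (~~ b) X p1
  | MNext _ p1 => mpos b X p1
  | MMu Z p1 => (Z == X) || mpos b X p1
  end.

(* dok tv Dl: the annotation is made of closed well-formed trace formulae
   on the trace variables tv in scope *)
Variable dok : seq nat -> D -> Prop.

Fixpoint mok (tv bound : seq nat) (p : mf D) : Prop :=
  match p with
  | MAtom d pi => tok d /\ pi \in tv
  | MVar X => X \in bound
  | MOr p1 p2 => mok tv bound p1 /\ mok tv bound p2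
  | MNot p1 => mok tv bound p1
  | MNext Dl p1 => dok tv Dl /\ mok tv bound p1
  | MMu X p1 => mpos true X p1 /\ mok tv (X :: bound) p1
  end.

Fixpoint hok (tv : seq nat) (f : hf D) : Prop :=
  match f with
  | HEx pi f1 => hok (pi :: tv) f1
  | HAll pi f1 => hok (pi :: tv) f1
  | HM p => mok tv [::] p
  end.

Definition hclosed (f : hf D) : Prop := hok [::] f.

Fixpoint mall_next (P : seq nat -> D -> Prop) (tv : seq nat) (p : mf D) : Prop :=
  match p with
  | MAtom _ _ | MVar _ => True
  | MOr p1 p2 => mall_next P tv p1 /\ mall_next P tv p2
  | MNot p1 => mall_next P tv p1
  | MNext Dl p1 => P tv Dl /\ mall_next P tv p1
  | MMu _ p1 => mall_next P tv p1
  end.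

Fixpoint hall_next (P : seq nat -> D -> Prop) (tv : seq nat) (f : hf D) : Prop :=
  match f with
  | HEx pi f1 | HAll pi f1 => hall_next P (pi :: tv) f1
  | HM p => mall_next P tv p
  end.

End Sem.

Definition mumD := nat -> tf.

Definition succ_mumble (d : tf) (tr : trace) (i j : nat) : Prop :=
  [/\ i < j, tsem tr V0 d j & forall k, i < k < j -> ~ tsem tr V0 d k]
  \/ ((forall k, i < k -> ~ tsem tr V0 d k) /\ j = i.+1).

Definition mum_step (Dl : mumD) (pi : nat) (tr : trace) (i j : nat) : Prop :=
  succ_mumble (Dl pi) tr i j.

Definition mum_dok (tv : seq nat) (Dl : mumD) : Prop :=
  forall pi, pi \in tv -> tok (Dl pi).

Definition mum_models (T : trace -> Prop) (f : hf mumD) := models mum_step T f.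

Definition mum_unique_closed (f : hf mumD) : Prop :=
  hclosed mum_dok f /\
  exists Dl0 : mumD,
    hall_next (fun tv Dl => forall pi, pi \in tv -> Dl pi = Dl0 pi) [::] f.

Definition stuD := nat -> seq tf.   (* finite sets of trace formulae as lists *)

Definition changes (g : seq tf) (tr : trace) (i k : nat) : Prop :=
  exists d, List.In d g /\ ~ (tsem tr V0 d i <-> tsem tr V0 d k).

Definition succ_stutter (g : seq tf) (tr : trace) (i j : nat) : Prop :=
  [/\ i < j, changes g tr i j & forall k, i < k < j -> ~ changes g tr i k]
  \/ ((forall k, i < k -> ~ changes g tr i k) /\ j = i.+1).

Definition stu_step (G : stuD) (pi : nat) (tr : trace) (i j : nat) : Prop :=
  succ_stutter (G pi) tr i j.

Definition stu_dok (tv : seq nat) (G : stuD) : Prop :=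
  forall pi, pi \in tv -> forall d, List.In d (G pi) -> tok d.

Definition stu_models (T : trace -> Prop) (f : hf stuD) := models stu_step T f.

(* closed formula of stuttering H_mu with unique stuttering
   (equality of the finite sets Gamma(pi), as sets) *)
Definition stu_unique_closed (f : hf stuD) : Prop :=
  hclosed stu_dok f /\
  exists G0 : stuD,
    hall_next (fun tv G => forall pi, pi \in tv ->
                 forall d, List.In d (G pi) <-> List.In d (G0 pi)) [::] f.

End Logic.

(* Main.v *)
(* With a unique annotation the multitrace formula is a linear-time mu-calculus
   formula over the run of position vectors visited from (0, ..., 0), so only
   the letters seen along the run matter.

   Call i a star position of a trace if d holds at i or at no position >= i;
   these are unbounded and the mumbling successor of i is the first star
   position > i.

   Stuttering to mumbling: past operators are unavailable, so the first position
   of a block of constant valuation cannot be recognised, but the last one can.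
   Mumble on "the valuation changes at the next position": stuttering time k+1
   is one position after mumbling time k if 0 is a star position, and one
   position after mumbling time k+1 otherwise.

   Mumbling to stuttering: let a position carry the colour of the first star
   position at or after it, where a colour consists of the atoms of the formula
   together with the parity of the number of star steps before these atoms next
   change. Consecutive star positions differ in colour, hence one stuttering step
   corresponds to one mumbling step, unless the atoms never change again, and
   then the pace is irrelevant. Mumbling time k+1 is matched to stuttering time
   k, again up to one star step depending on whether 0 is a star position.

   Both directions shift time by one. Time 0 never recurs, so it is handled by
   unfolding the formula there once, and the trace formula expressing the shift
   is selected by a case distinction at time 0. *)
Require Import Defs.
From mathcomp Require Import all_boot.
From Stdlib Require Import Classical ClassicalEpsilon FunctionalExtensionality.
From Stdlib Require List.

Set Implicit Arguments.
Unset Strict Implicit.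
Unset Printing Implicit Defensive.

Lemma ex_least (P : nat -> Prop) :
  (exists n, P n) -> exists n, P n /\ forall k, k < n -> ~ P k.
Proof.
case=> n; elim/ltn_ind: n => n IHn Pn.
have [[k [ltkn Pk]]|noP] := classic (exists k, k < n /\ P k); first exact: IHn Pk.
by exists n; split=> // k ltkn Pk; apply: noP; exists k.
Qed.

Lemma least_uniq (P : nat -> Prop) m n :
  P m -> (forall k, k < m -> ~ P k) -> P n -> (forall k, k < n -> ~ P k) ->
  m = n.
Proof.
move=> Pm minm Pn minn.
by case: (ltngtP m n) => // [/minn|/minm].
Qed.

(** * First occurrences *)

(** Common shape of both successors: convertible to [succ_mumble], and to [succ_stutter] when [R]
    says that the valuation differs from the one at [i]. *)
Definition first_or (R : nat -> Prop) (i j : nat) : Prop :=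
  [/\ i < j, R j & forall k, i < k < j -> ~ R k]
  \/ ((forall k, i < k -> ~ R k) /\ j = i.+1).

Definition nextpos (R : nat -> Prop) (i : nat) : nat :=
  epsilon (inhabits 0) (first_or R i).

Lemma first_or_ext R R' i j :
  (forall k, R k <-> R' k) -> first_or R i j <-> first_or R' i j.
Proof.
move=> eqR; split=> [[[ltij Rj noR]|[noR ->]]|[[ltij Rj noR]|[noR ->]]].
- by left; split=> // [|k /noR]; [exact/eqR | rewrite eqR].
- by right; split=> // k /noR; rewrite eqR.
- by left; split=> // [|k /noR]; [exact/eqR | rewrite eqR].
- by right; split=> // k /noR; rewrite eqR.
Qed.

Lemma first_or_ex R i : exists j, first_or R i j.
Proof.
have [[j Rj]|noR] := classic (exists j, i < j /\ R j).
  have [n [[ltin Rn] minn]] : exists n, (i < n /\ R n) /\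
      forall k, k < n -> ~ (i < k /\ R k) by apply: ex_least; exists j.
  by exists n; left; split=> // k /andP[ltik ltkn] Rk; case: (minn k ltkn).
by exists i.+1; right; split=> // k ltik Rk; apply: noR; exists k.
Qed.

Lemma first_or_uniq R i j j' : first_or R i j -> first_or R i j' -> j = j'.
Proof.
case=> [[ltij Rj minj]|[noR ->]] [[ltij' Rj' minj']|[noR' ->]] //.
- case: (ltngtP j j') => // ltjj.
    by case: (minj' j) => //; rewrite ltij.
  by case: (minj j') => //; rewrite ltij'.
- by case: (noR' j).
- by case: (noR j').
Qed.

Lemma first_orP R i j : first_or R i j <-> j = nextpos R i.
Proof.
have next_i : first_or R i (nextpos R i).
  by rewrite /nextpos; apply: epsilon_spec; apply: first_or_ex.
by split=> [/first_or_uniq/(_ next_i)|->].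
Qed.

Lemma nextpos_eq R i j : first_or R i j -> nextpos R i = j.
Proof. by move/first_orP. Qed.

(** Rounding up to [P]; meaningful once [P] is unbounded. *)
Definition upward (P : nat -> Prop) (i : nat) : nat :=
  epsilon (inhabits 0)
    (fun j => [/\ i <= j, P j & forall k, i <= k < j -> ~ P k]).

Section Upward.
Variable P : nat -> Prop.
Hypothesis Pinf : forall i, exists j, i <= j /\ P j.

Lemma upwardP i :
  [/\ i <= upward P i, P (upward P i) & forall k, i <= k < upward P i -> ~ P k].
Proof.
apply: (epsilon_spec (inhabits 0)
  (fun j => [/\ i <= j, P j & forall k, i <= k < j -> ~ P k])).
have [n [[ltin Pn] minn]] := ex_least (Pinf i).
by exists n; split=> // k /andP[leik ltkn] Pk; case: (minn k ltkn).
Qed.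

Lemma upward_eq i j :
  i <= j -> P j -> (forall k, i <= k < j -> ~ P k) -> upward P i = j.
Proof.
move=> leij Pj minj; have [leiu Pu minu] := upwardP i.
case: (ltngtP (upward P i) j) => // lt_u.
  by case: (minj (upward P i)) => //; rewrite leiu.
by case: (minu j) => //; rewrite leij.
Qed.

Lemma upward_id i : P i -> upward P i = i.
Proof. by move=> Pi; apply: upward_eq => // k; rewrite ltnNge; case: (i <= k). Qed.

Lemma upward_mid i k : i <= k <= upward P i -> upward P k = upward P i.
Proof.
have [leiu Pu minu] := upwardP i => /andP[leik leku].
apply: upward_eq => // l /andP[lekl ltlu]; apply: minu.
by rewrite (leq_trans leik).
Qed.

Lemma upwardS i : ~ P i -> upward P i.+1 = upward P i.
Proof.
have [leiu Pu minu] := upwardP i => nPi; apply: upward_mid.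
rewrite leqnSn /= ltn_neqAle leiu andbT.
by apply/negP=> /eqP def_i; apply: nPi; rewrite def_i.
Qed.


End Upward.
(** * Trace formulae *)

Section TraceFormulae.
Variable AP : finType.
Implicit Types (d e : tf AP) (tr : trace AP).

Definition tFalse : tf AP := TMu 0 (TVar AP 0).
Definition tAnd d e := TNot (TOr (TNot d) (TNot e)).
Definition tXor d e := TOr (tAnd d (TNot e)) (tAnd (TNot d) e).
Definition tOrs (l : seq (tf AP)) := foldr (@TOr AP) tFalse l.
Definition tF d := TMu 0 (TOr d (TNext Fg (TVar AP 0))).
Definition tstar d := TOr d (TNot (tF d)).
(* e holds at the first star position at or after the current one; the bound
   variable is 1 so that e may contain the variable 0 of teven. *)
Definition tN d e :=
  TMu 1 (TOr (tAnd (tstar d) e) (tAnd (TNot (tstar d)) (TNext Fg (TVar AP 1)))).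
Definition tQ d e := TNext Fg (tN d e).
(** Each unfolding makes two star steps past positions without [c], so the least fixpoint says that
    [c] is first met after an even number of star steps. *)
Definition teven d c :=
  TMu 0 (TOr c (tAnd (TNot c) (tQ d (tAnd (TNot c) (tQ d (TVar AP 0)))))).

Lemma tok_in_sub b b' d : {subset b <= b'} -> tok_in b d -> tok_in b' d.
Proof.
elim: d b b' => [a|Y|d IHd e IHe|d IHd|f d IHd|Y d IHd] b b' sub //=.
- exact: sub.
- by case/andP=> /(IHd _ _ sub)-> /(IHe _ _ sub).
- exact: IHd.
- exact: IHd.
case/andP=> ->; apply: IHd => Z; rewrite !inE => /orP[->//|/sub->].
by rewrite orbT.
Qed.

Lemma tok_weak b d : tok d -> tok_in b d.
Proof. exact: tok_in_sub. Qed.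

Lemma tpos_notin b bound Y d : tok_in bound d -> Y \notin bound -> tpos b Y d.
Proof.
elim: d b bound => [a|Z|d IHd e IHe|d IHd|f d IHd|Z d IHd] b bound //=.
- by move=> Zb nY; apply/orP; right; apply: contraNneq nY => <-.
- by case/andP=> okd oke nY; rewrite (IHd _ _ okd) // (IHe _ _ oke).
- exact: IHd.
- exact: IHd.
case/andP=> _ okd nY; case: eqP => //= ZY; apply: IHd okd _.
by rewrite inE negb_or nY andbT; apply/eqP=> YZ; apply: ZY.
Qed.

Lemma tpos_closed b Y d : tok d -> tpos b Y d.
Proof. by move/tpos_notin; apply. Qed.

Lemma tsem_agree tr b V V' d : tok_in b d ->
  (forall Y, Y \in b -> V Y = V' Y) -> tsem tr V d = tsem tr V' d.
Proof.
elim: d b V V' => [a|Y|d IHd e IHe|d IHd|f d IHd|Y d IHd] b V V' //=.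
- by move=> Yb; apply.
- by case/andP=> okd oke eqV; rewrite (IHd _ _ _ okd eqV) (IHe _ _ _ oke eqV).
- by move=> okd eqV; rewrite (IHd _ _ _ okd eqV).
- by move=> okd eqV; rewrite (IHd _ _ _ okd eqV).
case/andP=> _ okd eqV; apply: functional_extensionality => i.
have E I : tsem tr (updV V Y I) d = tsem tr (updV V' Y I) d.
  apply: IHd okd _ => Z; rewrite inE /updV; case: eqP => //= _; exact: eqV.
have EI : (fun I : nat -> Prop => (forall k, tsem tr (updV V Y I) d k -> I k) -> I i)
        = (fun I => (forall k, tsem tr (updV V' Y I) d k -> I k) -> I i).
  by apply: functional_extensionality => I; rewrite E.
by rewrite -[LHS]/(forall I, (fun I : nat -> Prop => _) I) EI.
Qed.

Lemma tsem_closed tr V d : tok d -> tsem tr V d = tsem tr (V0) d.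
Proof. by move=> okd; apply: tsem_agree okd _. Qed.

Lemma tFalseE tr V i : tsem tr V tFalse i <-> False.
Proof. by split=> //= /(_ (fun _ => False)); apply. Qed.

Lemma tOrE tr V d e i :
  tsem tr V (TOr d e) i <-> tsem tr V d i \/ tsem tr V e i.
Proof. by []. Qed.

Lemma tNotE tr V d i : tsem tr V (TNot d) i <-> ~ tsem tr V d i.
Proof. by []. Qed.

Lemma tAndE tr V d e i :
  tsem tr V (tAnd d e) i <-> tsem tr V d i /\ tsem tr V e i.
Proof. by rewrite /=; tauto. Qed.

Lemma tXorE tr V d e i :
  tsem tr V (tXor d e) i <-> ~ (tsem tr V d i <-> tsem tr V e i).
Proof. by rewrite /tXor tOrE !tAndE !tNotE; tauto. Qed.

Lemma tOrsE tr V l i :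
  tsem tr V (tOrs l) i <-> exists d, List.In d l /\ tsem tr V d i.
Proof.
elim: l => [|d l IHl]; first by rewrite tFalseE; split=> // -[d []].
rewrite tOrE IHl.
split=> [[di|[e [le ei]]]|[e [[<-|le] ei]]].
- by exists d; split=> //; left.
- by exists e; split=> //; right.
- by left.
- by right; exists e.
Qed.

Lemma tnextE tr V d i : tsem tr V (TNext Fg d) i <-> tsem tr V d i.+1.
Proof. by split=> [[j [-> //]]|di] /=; exists i.+1. Qed.

Lemma tFE tr V d i : tok d ->
  tsem tr V (tF d) i <-> exists j, i <= j /\ tsem tr V0 d j.
Proof.
move=> okd; rewrite /tF /=; split.
  move/(_ (fun i => exists j, i <= j /\ tsem tr V0 d j)); apply=> k.
  rewrite (tsem_closed _ _ okd) => -[dk|[j [-> [l [ltkl dl]]]]].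
    by exists k.
  by exists l; split=> //; apply: ltnW.
case=> j [leij dj] I closedI.
have [n def_j] : exists n, j = i + n by exists (j - i); rewrite subnKC.
elim: n i def_j {leij} => [|n IHn] i def_j; apply: closedI.
  by left; rewrite (tsem_closed _ _ okd) -(addn0 i) -def_j.
by right; exists i.+1; split=> //; apply: IHn; rewrite addSnnS.
Qed.

Lemma tok_tF d : tok d -> tok (tF d).
Proof.
by move=> okd; rewrite /tok /= (tpos_closed _ _ okd) (tok_weak _ okd).
Qed.

Lemma tok_star d : tok d -> tok (tstar d).
Proof. by move=> okd; have := tok_tF okd; rewrite /tok /= => ->; rewrite andbT. Qed.

Lemma starE tr V d i : tok d ->
  tsem tr V (tstar d) i <->
  tsem tr V0 d i \/ forall j, i <= j -> ~ tsem tr V0 d j.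
Proof.
move=> okd; rewrite tOrE tNotE tFE // (tsem_closed _ _ okd); split=> -[di|nd]; [by left|right|by left|right].
  by move=> j leij dj; apply: nd; exists j.
by case=> j [leij]; apply: nd.
Qed.

Definition star d tr : nat -> Prop := tsem tr V0 (tstar d).

(** If [d] occurs at or after [i], that occurrence serves; otherwise [i] itself is a star
    position. *)
Lemma star_inf d tr i : tok d -> exists j, i <= j /\ star d tr j.
Proof.
move=> okd; have [[j [leij dj]]|nd] := classic (exists j, i <= j /\ tsem tr V0 d j).
  by exists j; split=> //; apply/(starE _ _ _ okd); left.
exists i; split=> //; apply/(starE _ _ _ okd); right=> j leij dj.
by apply: nd; exists j.
Qed.

(** The default value [i.+1] needs no special treatment: when [d] never holds after [i], the
    position [i.+1] is itself a star position. *)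
Lemma nextpos_star d tr i : tok d ->
  nextpos (tsem tr V0 d) i = upward (star d tr) i.+1.
Proof.
move=> okd; apply: nextpos_eq.
have [ltiu + minu] := upwardP (fun i => star_inf tr i okd) i.+1.
rewrite /star starE // => -[du|nd].
  by left; split=> // k /minu nk dk; apply: nk; apply/(starE _ _ _ okd); left.
have nd' k : i < k -> ~ tsem tr V0 d k.
  move=> ltik; case: (leqP (upward (star d tr) i.+1) k) => [|ltku]; first exact: nd.
  by move=> dk; case: (minu k); [rewrite ltik | apply/(starE _ _ _ okd); left].
right; split=> //; apply: (upward_eq (fun j => star_inf tr j okd)) => [//||k].
  by apply/(starE _ _ _ okd); right=> j; apply: nd'.
by case/andP=> ltik; rewrite ltnS leqNgt ltik.
Qed.

Lemma tok_in_tN b d e : tok d -> tpos true 1 e -> tok_in (1 :: b) e ->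
  tok_in b (tN d e).
Proof.
move=> okd pe oke; have oks := tok_star okd.
rewrite /tN /tAnd; cbn [tok_in tpos negb].
by rewrite !(tpos_closed _ _ oks) !(tok_weak _ oks) pe oke.
Qed.

Lemma tok_tN d e : tok d -> tok e -> tok (tN d e).
Proof.
by move=> okd oke; apply: tok_in_tN => //; [apply: tpos_closed|apply: tok_weak].
Qed.

Lemma tok_tQ d e : tok d -> tok e -> tok (tQ d e).
Proof. exact: tok_tN. Qed.

(** The hypothesis on [updV] says that [e] does not depend on the variable bound by [tN]. Other free
    variables stay allowed, as [teven] requires. *)
Lemma tNE tr V d e i : tok d ->
  (forall I k, tsem tr (updV V 1 I) e k <-> tsem tr V e k) ->
  tsem tr V (tN d e) i <-> tsem tr V e (upward (star d tr) i).
Proof.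
move=> okd eq_e; have oks := tok_star okd.
have inf j : exists k, j <= k /\ star d tr k by apply: star_inf.
rewrite /tN.
pose body := TOr (tAnd (tstar d) e) (tAnd (TNot (tstar d)) (TNext Fg (TVar AP 1))).
have bodyE I k : tsem tr (updV V 1 I) body k <->
    star d tr k /\ tsem tr V e k \/ ~ star d tr k /\ I k.+1.
  rewrite /body tOrE !tAndE tNotE tnextE eq_e.
  by rewrite (tsem_closed _ _ oks).
rewrite -[tsem _ _ _ _]/(forall I : nat -> Prop,
   (forall k, tsem tr (updV V 1 I) body k -> I k) -> I i); split.
  move/(_ (fun i => tsem tr V e (upward (star d tr) i))); apply=> k.
  by case/bodyE=> -[sk]; [rewrite (upward_id inf) | rewrite (upwardS inf)].
(* Induction on the distance to the next star position. *)
move=> eu I closedI; have [n def_n] : exists n, upward (star d tr) i - i = n by eexists.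
elim: n i eu def_n => [|n IHn] i eu def_n; apply: closedI; apply/bodyE.
  left; have [leiu su _] := upwardP inf i.
  have def_i : upward (star d tr) i = i.
    by apply/eqP; rewrite eqn_leq leiu andbT -subn_eq0 def_n.
  by rewrite def_i in su eu.
have [si|nsi] := classic (star d tr i); first by left; rewrite (upward_id inf) in eu.
right; split=> //; apply: IHn; first by rewrite (upwardS inf).
by rewrite (upwardS inf) // subnS def_n.
Qed.

Lemma tNE_closed tr V d e i : tok d -> tok e ->
  tsem tr V (tN d e) i <-> tsem tr V0 e (upward (star d tr) i).
Proof.
move=> okd oke; rewrite tNE // => [|I k]; first by rewrite tsem_closed.
by rewrite tsem_closed // [in X in _ <-> X]tsem_closed.
Qed.

Lemma tQE_closed tr V d e i : tok d -> tok e ->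
  tsem tr V (tQ d e) i <-> tsem tr V0 e (upward (star d tr) i.+1).
Proof. by move=> okd oke; rewrite tnextE tNE_closed. Qed.

End TraceFormulae.

(** When [k] grows by one, the rounded position makes one step exactly if the old [k] lies in [P],
    and stays put otherwise. *)
Lemma upward_iter (P : nat -> Prop) i k :
  (forall i, exists j, i <= j /\ P j) -> i <= k ->
  exists n, upward P k = iter n (fun x => upward P x.+1) (upward P i).
Proof.
move=> inf leik; rewrite -(subnKC leik); elim: (k - i) => [|j [n IHj]].
  by exists 0; rewrite addn0.
rewrite addnS; have [Pk|nPk] := classic (P (i + j)).
  by exists n.+1; rewrite iterS -IHj (upward_id inf Pk).
by exists n; rewrite (upwardS inf).
Qed.

(** * Parity of the distance to a set along iterates *)

Section EvenDistance.
Variables (Q : nat -> nat) (X : nat -> Prop).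

Definition even_dist (x : nat) : Prop :=
  exists n, X (iter n.*2 Q x) /\ forall m, m < n.*2 -> ~ X (iter m Q x).

Lemma even_dist_least n x : X (iter n Q x) ->
  (forall m, m < n -> ~ X (iter m Q x)) -> even_dist x <-> ~~ odd n.
Proof.
move=> Xn minn; split=> [[k [Xk mink]]|evn].
  rewrite (least_uniq (P := fun n => X (iter n Q x)) Xn minn Xk mink).
  by rewrite odd_double.
by exists n./2; rewrite even_halfK.
Qed.

(** Since [X] fails at [x], the least hitting time is positive; one step decreases it by one and
    flips its parity. *)
Lemma even_dist_flip x : (exists n, X (iter n Q x)) -> ~ X x ->
  ~ (even_dist x <-> even_dist (Q x)).
Proof.
case/ex_least=> -[|n] [Xn minn] nXx; first by [].
rewrite (even_dist_least Xn minn) (@even_dist_least n (Q x)).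
- by rewrite /=; case: (odd n) => -[h1 h2]; [have := h1 isT|have := h2 isT].
- by rewrite -iterSr.
- by move=> m ltmn; rewrite -iterSr; apply: minn.
Qed.

End EvenDistance.

(** * Colours of positions and the formulae expressing them *)

Section Atoms.
Variable AP : finType.
Implicit Types (d e c : tf AP) (tr : trace AP) (L G : seq (tf AP)).

Definition starQ d tr (x : nat) : nat := upward (star d tr) x.+1.

Lemma tok_in_TOr b d e : tok_in b d -> tok_in b e -> tok_in b (TOr d e).
Proof. by move=> /= -> ->. Qed.

Lemma tok_tXor d e : tok d -> tok e -> tok (tXor d e).
Proof. by rewrite /tok /= => -> ->. Qed.

Lemma tok_tOrs L : (forall e, List.In e L -> tok e) -> tok (tOrs L).
Proof.
elim: L => //= d L IHL okL; apply: tok_in_TOr; first by apply: okL; left.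
by apply: IHL => e Le; apply: okL; right.
Qed.

Lemma tok_teven d c : tok d -> tok c -> tok (teven d c).
Proof.
move=> okd okc; have oks := tok_star okd.
rewrite /tok /teven /tQ /tN /tAnd; cbn [tok_in tpos negb].
by rewrite !(tpos_closed _ _ oks) !(tok_weak _ oks) !(tpos_closed _ _ okc)
           !(tok_weak _ okc).
Qed.

Lemma tevenE tr V d c i : tok d -> tok c ->
  tsem tr V (teven d c) i <-> even_dist (starQ d tr) (tsem tr V0 c) i.
Proof.
move=> okd okc; pose X := tsem tr (@V0) c; pose Q := starQ d tr.
rewrite /teven.
pose body := TOr c (tAnd (TNot c) (tQ d (tAnd (TNot c) (tQ d (TVar AP 0))))).
have bodyE I k : tsem tr (updV V 0 I) body k <->
    X k \/ ~ X k /\ ~ X (Q k) /\ I (Q (Q k)).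
  (* The side goal left by [tNE] is that the nested formula ignores variable 1; it is proved by
     evaluating the inner [tQ] in the same way. *)
  rewrite /body tOrE tAndE tNotE /tQ tnextE (tNE _ okd) => [|J l].
    rewrite tAndE tNotE tnextE (tNE _ okd) => [|J l //].
    by rewrite !(tsem_closed _ _ okc).
  rewrite !tAndE !tNotE !tnextE !(tNE _ okd) => [|J' l' //|J' l' //].
  by rewrite !(tsem_closed _ _ okc).
rewrite -[tsem _ _ _ _]/(forall I : nat -> Prop,
   (forall k, tsem tr (updV V 0 I) body k -> I k) -> I i); split.
  apply=> k /bodyE[Xk|[nXk [nXQk [n [Xn minn]]]]]; first by exists 0.
  exists n.+1; rewrite doubleS !iterSr; split=> // -[|[|m]] //.
  by rewrite !iterSr !ltnS; apply: minn.
case=> n; elim: n i => [|n IHn] i [Xn minn] I closedI; apply: (closedI); apply/bodyE.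
  by left.
right; split; first exact: (minn 0).
split; first exact: (minn 1).
apply: IHn closedI; rewrite doubleS !iterSr in Xn minn *; split=> // m ltm.
by have := minn m.+2; rewrite !iterSr !ltnS; apply.
Qed.

Definition letter_change d L := tOrs (List.map (fun e => tXor e (tQ d e)) L).

(** The colour of a position: parity bit and atoms, all read at the first star position at or after
    it. *)
Definition stutter_basis d L :=
  List.map (tN d) (teven d (letter_change d L) :: L).

(** [R] takes the current position because the stuttering condition compares with it. *)
Definition pos (R : nat -> nat -> Prop) (k : nat) : nat :=
  iter k (fun i => nextpos (R i) i) 0.

(** * Comparing mumbling and stuttering on one trace *)

Section MumbleToStutter.
Variables (d : tf AP) (L : seq (tf AP)) (tr : trace AP).
Hypotheses (okd : tok d) (okL : forall e, List.In e L -> tok e).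

Let q := upward (star d tr).
Let Q := starQ d tr.
Let c := letter_change d L.
Let inf i : exists j, i <= j /\ star d tr j := star_inf tr i okd.

Lemma tok_letter_change : tok (letter_change d L).
Proof.
apply: tok_tOrs => e /List.in_map_iff[e' [<- Le]].
by have oke := okL Le; apply: tok_tXor => //; apply: tok_tQ.
Qed.

Lemma tok_stutter_basis e : List.In e (stutter_basis d L) -> tok e.
Proof.
case/List.in_map_iff=> e' [<- [<-|Le]]; apply: tok_tN => //; last exact: okL.
by apply: tok_teven => //; apply: tok_letter_change.
Qed.

Definition same_letter x y :=
  forall e, List.In e L -> tsem tr V0 e x <-> tsem tr V0 e y.

Lemma letter_changeE x : tsem tr V0 c x <-> ~ same_letter x (Q x).
Proof.
rewrite /c /letter_change tOrsE; split.
  case=> e [/List.in_map_iff[e' [<- Le]]] /tXorE.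
  by rewrite (tQE_closed _ _ _ okd (okL Le)) => ne same; apply: ne; apply: same.
move=> nsame; apply: NNPP => noe; apply: nsame => e Le; apply: NNPP => ne.
apply: noe; exists (tXor e (tQ d e)); split.
  by apply/List.in_map_iff; exists e.
by apply/tXorE; rewrite (tQE_closed _ _ _ okd (okL Le)).
Qed.

Lemma changes_basis i k : changes (stutter_basis d L) tr i k <->
  ~ (same_letter (q i) (q k) /\
     (even_dist Q (tsem tr V0 c) (q i) <-> even_dist Q (tsem tr V0 c) (q k))).
Proof.
have okc : tok c := tok_letter_change; have oke := tok_teven okd okc.
split=> [[_ [/List.in_map_iff[e [<- [<-|Le]]]]]|nsame].
- by rewrite !tNE_closed // !tevenE // => ne [_ /ne].
- by rewrite !(tNE_closed _ _ _ okd (okL Le)) => ne [/(_ e Le)/ne].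
apply: NNPP => noch; apply: nsame; split=> [e Le|].
  apply: NNPP => ne; apply: noch; exists (tN d e); split.
    by apply/List.in_map_iff; exists e; split=> //; right.
  by rewrite !(tNE_closed _ _ _ okd (okL Le)).
apply: NNPP => ne; apply: noch; exists (tN d (teven d c)); split.
  by apply/List.in_map_iff; exists (teven d c); split=> //; left.
by rewrite !tNE_closed // !tevenE.
Qed.

(* Comparing whole letter streams, rather than requiring m = q s, covers the
   constant tail, where the two runs drift apart. *)
Definition matched m s := forall n, same_letter (iter n Q m) (iter n Q (q s)).

(** If the letter still changes along star steps from [q s], then [q s] and its star successor
    differ in colour: equal letters force the parity to flip. The stuttering step then ends at
    [(q s).+1]. Otherwise letter and parity bit are constant from [q s] on, and stuttering takes its
    default step. *)
Lemma matched_step m s : matched m s ->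
  matched (Q m) (nextpos (changes (stutter_basis d L) tr s) s).
Proof.
move=> Jms; have [lesq sq _] := upwardP inf s.
have qmid k : s < k < (q s).+1 -> q k = q s.
  by case/andP=> ltsk ltkq; apply: (upward_mid inf); rewrite (ltnW ltsk).
have [exc|noc] := classic (exists n, tsem tr V0 c (iter n Q (q s))).
  have -> : nextpos (changes (stutter_basis d L) tr s) s = (q s).+1.
    apply: nextpos_eq; left; split; first by rewrite ltnS.
      apply/changes_basis; rewrite -[q (q s).+1]/(Q (q s)) => -[same].
      by apply: even_dist_flip => // /letter_changeE[].
    by move=> k /qmid qk /changes_basis[]; rewrite qk.
  by move=> n; have := Jms n.+1; rewrite !iterSr.
have noc' n : ~ tsem tr V0 c (iter n Q (q s)) by move=> cn; apply: noc; exists n.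
have const n : same_letter (q s) (iter n Q (q s)).
  elim: n => [//|n IHn] e Le; rewrite (IHn e Le) iterS.
  suff same : same_letter (iter n Q (q s)) (Q (iter n Q (q s))) by apply: same.
  by apply: NNPP => /letter_changeE; apply: noc'.
have noeven n : ~ even_dist Q (tsem tr V0 c) (iter n Q (q s)).
  by case=> k [ck _]; apply: (noc' (k.*2 + n)); rewrite iterD.
have -> : nextpos (changes (stutter_basis d L) tr s) s = s.+1.
  apply: nextpos_eq; right; split=> // k ltsk /changes_basis[].
  have [n qk] := upward_iter inf (ltnW ltsk).
  rewrite -[upward _ s]/(q s) -[upward _ k]/(q k) in qk; rewrite qk.
  split; first exact: const.
  by split=> [/(noeven 0)|/noeven].
(* Rounding up [s.+1] gives some iterate of [Q] on [q s], and all these iterates carry the same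
   letter. *)
move=> n e Le; have [n' qs1] := upward_iter inf (leqnSn s).
rewrite /q qs1 -iterD -/(q s) -/Q -(const _ e Le) -iterSr (Jms n.+1 e Le).
by rewrite -(const _ e Le).
Qed.

(** With [b], rounding up the stuttering position at time [k] matches mumbling time [k], so one more
    star step is needed; without [b], it already matches time [k.+1]. *)
Definition stutter_atom (b : bool) d e := if b then tN d (tQ d e) else tN d e.

Lemma mumble_atom_stutter (b : bool) e k : List.In e L ->
  b <-> tsem tr V0 (tstar d) 0 ->
  tsem tr V0 e (pos (fun _ => tsem tr V0 d) k.+1) <->
  tsem tr V0 (stutter_atom b d e) (pos (changes (stutter_basis d L) tr) k).
Proof.
move=> Le b0; have oke := okL Le.
set m := pos _; set s := pos _.
have mS j : m j.+1 = Q (m j) by rewrite /m /pos iterS nextpos_star.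
have [m0 s0] : m 0 = 0 /\ s 0 = 0 by [].
have sS j : s j.+1 = nextpos (changes (stutter_basis d L) tr (s j)) (s j) by [].
case: b b0 => b0; rewrite /stutter_atom.
  have Jk : matched (m k) (s k).
    elim: k => [|k IHk]; last by rewrite mS sS; apply: matched_step.
    by move=> n; rewrite /q s0 (upward_id inf) //; apply/b0.
  by rewrite tNE_closed ?tok_tQ // tQE_closed // mS; apply: (Jk 1).
have Jk : matched (m k.+1) (s k).
  elim: k => [|k IHk]; last by rewrite mS sS; apply: matched_step.
  (* As 0 is not a star position, rounding up 0 and rounding up 1 agree. *)
  move=> n; rewrite mS m0 s0 /Q /starQ (upwardS inf) //.
  by move/b0.
by rewrite tNE_closed //; apply: (Jk 0).
Qed.

End MumbleToStutter.

(** * Stuttering steps through ends of constant blocks *)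

Section StutterToMumble.
Variables (G : seq (tf AP)) (tr : trace AP).
Hypothesis okG : forall e, List.In e G -> tok e.

Definition block_end L := tOrs (List.map (fun e => tXor e (TNext Fg e)) L).

Lemma tok_block_end : tok (block_end G).
Proof.
apply: tok_tOrs => e /List.in_map_iff[e' [<- Ge]].
by apply: tok_tXor; exact: (okG Ge).
Qed.

Let d := block_end G.
Let q := upward (star d tr).
Let inf i : exists j, i <= j /\ star d tr j := star_inf tr i tok_block_end.

Lemma block_endE i : tsem tr V0 d i <-> changes G tr i i.+1.
Proof.
rewrite /d /block_end tOrsE; split=> [[e [/List.in_map_iff[e' [<- Ge]]]]|[e [Ge ne]]].
  by rewrite tXorE tnextE => ne; exists e'.
exists (tXor e (TNext Fg e)); split; first by apply/List.in_map_iff; exists e.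
by rewrite tXorE tnextE.
Qed.

Lemma nochangeP i k :
  ~ changes G tr i k <-> forall e, List.In e G -> tsem tr V0 e i <-> tsem tr V0 e k.
Proof.
split=> [noch e Ge|same [e [/same Ge []]] //].
by apply: NNPP => ne; apply: noch; exists e.
Qed.

Lemma nochange_block i k : i <= k ->
  (forall j, i <= j < k -> ~ tsem tr V0 d j) -> ~ changes G tr i k.
Proof.
move=> leik; rewrite -(subnKC leik); elim: (k - i) => [|n IHn] nod.
  by rewrite addn0; apply/nochangeP.
apply/nochangeP=> e Ge; have /nochangeP-> // : ~ changes G tr i (i + n).
  apply: IHn => j /andP[leij ltj]; apply: nod; rewrite leij /=.
  by rewrite addnS ltnS ltnW.
have: ~ tsem tr V0 d (i + n) by apply: nod; rewrite leq_addr addnS /=.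
by rewrite block_endE addnS => /nochangeP; apply.
Qed.

(** Nothing changes from [i] up to the block end [q i], and something does right after it. If no
    block ends any more, then [q i] is [i] and the stuttering default gives the same value. *)
Lemma nextpos_changes i : nextpos (changes G tr i) i = (q i).+1.
Proof.
have [leiq sq minq] := upwardP inf i; rewrite -/q in leiq sq minq.
have okd := tok_block_end.
have nod j : i <= j < q i -> ~ tsem tr V0 d j.
  by move=> /minq ns dj; apply: ns; apply/(starE _ _ _ okd); left.
have noch k : i <= k <= q i -> ~ changes G tr i k.
  case/andP=> leik lekq; apply: nochange_block => // j /andP[leij ltjk].
  by apply: nod; rewrite leij (leq_trans ltjk).
apply: nextpos_eq; case/(starE _ _ _ okd): (sq) => [dq|ndq].
  left; split=> [||k /andP[ltik ltkq]]; first by rewrite ltnS.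
    apply: NNPP => /nochangeP same; move/block_endE: dq; apply/nochangeP=> e Ge.
    rewrite -(same e Ge); suff /nochangeP-> // : ~ changes G tr i (q i) by [].
    by apply: noch; rewrite leiq leqnn.
  by apply: noch; rewrite (ltnW ltik).
have nd j : i <= j -> ~ tsem tr V0 d j.
  by move=> leij; case: (leqP (q i) j) => [/ndq|ltjq] //; apply: nod; rewrite leij.
right; split=> [k ltik|]; last first.
  by rewrite /q (upward_id inf) //; apply/(starE _ _ _ okd); right.
by apply: nochange_block => [|j /andP[leij _]]; [apply: ltnW|apply: nd].
Qed.

Definition mumble_atom (b : bool) L e :=
  if b then TNext Fg e else tQ (block_end L) (TNext Fg e).

(** Stuttering positions after time 0 are successors of star positions, and mumbling positions after
    time 0 are star positions. So the runs differ by one position, with a time offset fixed by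
    [b]. *)
Lemma stutter_atom_mumble (b : bool) e k : tok e ->
  b <-> tsem tr V0 (tstar (block_end G)) 0 ->
  tsem tr V0 e (pos (changes G tr) k.+1) <->
  tsem tr V0 (mumble_atom b G e) (pos (fun _ => tsem tr V0 (block_end G)) k).
Proof.
move=> oke b0; have okd := tok_block_end.
set s := pos _; set m := pos _.
have [m0 s0] : m 0 = 0 /\ s 0 = 0 by [].
have sS j : s j.+1 = (q (s j)).+1 by rewrite /s /pos iterS nextpos_changes.
have mS j : m j.+1 = q (m j).+1 by rewrite /m /pos iterS nextpos_star.
case: b b0 => b0; rewrite /mumble_atom.
  suff -> : s k.+1 = (m k).+1 by rewrite tnextE.
  elim: k => [|k IHk]; last by rewrite sS IHk mS.
  by rewrite sS s0 /q (upward_id inf) //; apply/b0.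
suff -> : s k.+1 = (m k.+1).+1 by rewrite tQE_closed // tnextE mS.
elim: k => [|k IHk]; last by rewrite sS IHk [in RHS]mS.
by rewrite sS mS s0 m0 /q (upwardS inf) // => /b0.
Qed.

End StutterToMumble.
End Atoms.

(** * Multitrace formulae as linear-time formulae *)

Section LinearTime.
Variable AP : finType.

(** [A d pi k] is the truth of an atom at time [k] of a fixed run. The annotation of [MNext] is
    dropped, since the run already incorporates it. *)
Fixpoint lsem (D : Type) (A : tf AP -> nat -> nat -> Prop)
  (V : nat -> nat -> Prop) (p : mf AP D) : nat -> Prop :=
  match p with
  | MAtom d pi => A d pi
  | MVar X => V X
  | MOr p1 p2 => fun k => lsem A V p1 k \/ lsem A V p2 k
  | MNot p1 => fun k => ~ lsem A V p1 k
  | MNext _ p1 => fun k => lsem A V p1 k.+1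
  | MMu X p1 => fun k => forall S : nat -> Prop,
      (forall u, lsem A (updV V X S) p1 u -> S u) -> S k
  end.

Fixpoint mall_atom (D : Type) (P : tf AP -> nat -> Prop) (p : mf AP D) : Prop :=
  match p with
  | MAtom d pi => P d pi
  | MVar _ => True
  | MOr p1 p2 => mall_atom P p1 /\ mall_atom P p2
  | MNot p1 | MNext _ p1 | MMu _ p1 => mall_atom P p1
  end.

Fixpoint matoms (D : Type) (p : mf AP D) : seq (tf AP) :=
  match p with
  | MAtom d _ => [:: d]
  | MVar _ => [::]
  | MOr p1 p2 => matoms p1 ++ matoms p2
  | MNot p1 | MNext _ p1 | MMu _ p1 => matoms p1
  end.

Section Formulae.
Variable D : Type.
Implicit Types (p q : mf AP D) (A : tf AP -> nat -> nat -> Prop).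

Definition mFalse : mf AP D := MMu 0 (MVar AP D 0).
Definition mAnd p q := MNot (MOr (MNot p) (MNot q)).

Lemma lsem_False A V k : lsem A V mFalse k <-> False.
Proof. by split=> //= /(_ (fun _ => False)); apply. Qed.

Lemma mok_atoms dok tv b (P : tf AP -> nat -> Prop) p : mok dok tv b p ->
  (forall d pi, List.In d (matoms p) -> tok d -> pi \in tv -> P d pi) ->
  mall_atom P p.
Proof.
elim: p b => [d pi|Z|p IHp q IHq|p IHp|E p IHp|X p IHp] b //=.
- by case=> okd pitv; apply=> //; left.
- case=> okp okq allP; split; [apply: IHp okp _|apply: IHq okq _];
    move=> d pi dp; apply: allP; apply/List.in_app_iff; by [left|right].
- exact: IHp.
- by case=> _; apply: IHp.
- by case=> _; apply: IHp.
Qed.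

Lemma mok_tok dok tv b p d : mok dok tv b p -> List.In d (matoms p) -> tok d.
Proof.
elim: p b => [d' pi|Z|p IHp q IHq|p IHp|E p IHp|X p IHp] b //=.
- by case=> okd _ [<-|].
- by case=> okp okq /List.in_app_iff[]; [apply: IHp okp|apply: IHq okq].
- exact: IHp.
- by case=> _; apply: IHp.
- by case=> _; apply: IHp.
Qed.

Lemma mok_sub dok tv b b' p : {subset b <= b'} -> mok dok tv b p -> mok dok tv b' p.
Proof.
elim: p b b' => [d pi|X|p IHp q IHq|p IHp|E p IHp|X p IHp] b b' sub //=.
- exact: sub.
- by case=> /(IHp _ _ sub) okp /(IHq _ _ sub).
- exact: IHp.
- by case=> okE /(IHp _ _ sub).
case=> -> okp; split=> //; apply: IHp okp => Y.
by rewrite !inE => /orP[->//|/sub->]; rewrite orbT.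
Qed.

Lemma mok_weak dok tv b p : mok dok tv [::] p -> mok dok tv b p.
Proof. exact: mok_sub. Qed.

Lemma mpos_notin dok tv bound b X p :
  mok dok tv bound p -> X \notin bound -> mpos b X p.
Proof.
elim: p b bound => [d pi|Y|p IHp q IHq|p IHp|E p IHp|Y p IHp] b bound //=.
- by move=> Yb nX; apply/orP; right; apply: contraNneq nX => <-.
- by case=> okp okq nX; rewrite (IHp _ _ okp nX) (IHq _ _ okq nX).
- exact: IHp.
- by case=> _; apply: IHp.
case=> _ okp nX; case: eqP => //= YX; apply: IHp okp _.
by rewrite inE negb_or nX andbT; apply/eqP=> XY; apply: YX.
Qed.

(** With equality to [E] as its annotation condition, [mok] expresses well-formedness and uniqueness
    of the annotation at once. *)
Lemma mok_const (dok P : seq nat -> D -> Prop) (E : D) tv b p :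
  mok (fun _ E' => E' = E) tv b p -> dok tv E -> P tv E ->
  mok dok tv b p /\ mall_next P tv p.
Proof.
move=> + okE PE; elim: p b => [d pi|Z|p IHp q IHq|p IHp|E' p IHp|X p IHp] b //=.
- by case=> /IHp[okp allp] /IHq[okq allq].
- exact: IHp.
- by case=> -> /IHp[].
- by case=> -> /IHp[].
Qed.

Lemma lsem_ext A V V' p : (forall X k, V X k <-> V' X k) ->
  forall k, lsem A V p k <-> lsem A V' p k.
Proof.
elim: p V V' => [d pi|X|p IHp q IHq|p IHp|E p IHp|X p IHp] V V' eqV k //=.
- by rewrite (IHp _ _ eqV) (IHq _ _ eqV).
- by rewrite (IHp _ _ eqV).
- exact: IHp.
have eqS S : forall Y k, updV V X S Y k <-> updV V' X S Y k.
  by move=> Y l; rewrite /updV; case: eqP.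
by split=> fixS S closedS; apply: fixS => u /(IHp _ _ (eqS S)) /closedS.
Qed.

(** Both polarities are proved together so that the induction passes through negation. *)
Lemma lsem_mono A X p V V' : (forall Y, Y != X -> forall k, V Y k <-> V' Y k) ->
  (forall k, V X k -> V' X k) ->
  forall k, (mpos true X p -> lsem A V p k -> lsem A V' p k) /\
            (mpos false X p -> lsem A V' p k -> lsem A V p k).
Proof.
elim: p V V' => [d pi|Y|p IHp q IHq|p IHp|E p IHp|Y p IHp] V V' eqV leV k //=.
- split=> [_|neqY]; last by apply: (eqV Y neqY k).2.
  by have [->|neqY] := eqVneq Y X; [apply: leV|apply: (eqV Y neqY k).1].
- have [h1 h2] := IHp _ _ eqV leV k; have [h3 h4] := IHq _ _ eqV leV k.
  by split=> /andP[] => [/h1 f /h3 g|/h2 f /h4 g] [/f|/g]; [left|right|left|right].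
- have [h1 h2] := IHp _ _ eqV leV k.
  by split=> [/h2 h np /h|/h1 h np /h].
- exact: IHp.
have [->|neqYX] := eqVneq Y X => /=.
  have eqS S : forall Z k, updV V X S Z k <-> updV V' X S Z k.
    by move=> Z l; rewrite /updV; case: eqP => // /eqP/eqV.
  by split=> _ fixS S closedS; apply: fixS => u /(lsem_ext A p (eqS S)) /closedS.
have eqS S : forall Z, Z != X -> forall k, updV V Y S Z k <-> updV V' Y S Z k.
  by move=> Z neqZ l; rewrite /updV; case: eqP => // _; apply: eqV.
have leS S : forall k, updV V Y S X k -> updV V' Y S X k.
  by move=> l; rewrite /updV eq_sym (negPf neqYX); apply: leV.
split=> posp fixS S closedS; apply: fixS => u pu; apply: closedS.
  by apply: (IHp _ _ (eqS S) (leS S) u).1 pu.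
by apply: (IHp _ _ (eqS S) (leS S) u).2 pu.
Qed.

Lemma updV_mono A V X (S S' : nat -> Prop) p k : mpos true X p ->
  (forall l, S l -> S' l) ->
  lsem A (updV V X S) p k -> lsem A (updV V X S') p k.
Proof.
move=> posp leS; have [] := @lsem_mono A X p (updV V X S) (updV V X S') _ _ k.
- by move=> Y neqY l; rewrite /updV (negPf neqY).
- by move=> l; rewrite /updV eqxx; apply: leS.
by move=> mono _; apply: mono.
Qed.

(** A least fixpoint cannot justify membership of 0 by membership of 0, so its unfolding at 0 may
    take the variable to be false there. *)
Lemma lsem_mu0 A V X p : mpos true X p ->
  lsem A V (MMu X p) 0 <->
  lsem A (updV V X (fun k => 0 < k /\ lsem A V (MMu X p) k)) p 0.
Proof.
move=> posp; set mu := lsem A V (MMu X p); set mu' := fun k => _.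
have mu_le S : (forall u, lsem A (updV V X S) p u -> S u) -> forall k, mu k -> S k.
  by move=> closedS k; apply.
have mu_closed k : lsem A (updV V X mu) p k -> mu k.
  move=> pk S closedS; apply: (closedS).
  by apply: updV_mono posp _ pk; apply: mu_le.
split=> [mu0|]; last first.
  by move=> p0; apply: mu_closed; apply: updV_mono posp _ p0 => l [].
(* [S] is a prefixed point: if it contains 0, the claim is its second component; otherwise it lies
   below [mu']. *)
pose S k := mu k /\ (k = 0 -> lsem A (updV V X mu') p 0).
suff /mu_le/(_ 0 mu0)[_] : forall u, lsem A (updV V X S) p u -> S u by apply.
move=> u pu; split.
  by apply: mu_closed; apply: updV_mono posp _ pu => l [].
move=> u0; subst u; have [S0|nS0] := classic (S 0); first exact: S0.2.
by apply: updV_mono posp _ pu => -[//|l] [mul _].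
Qed.

End Formulae.

(** * Formulae about the run shifted by one *)

Section Shift.
Variables (D E : Type) (h : tf AP -> nat -> tf AP) (E0 : E).
Implicit Types (p : mf AP D) (s : nat -> option (mf AP E)).

Definition upd_sub s X o := fun Y => if Y == X then o else s Y : option (mf AP E).

(** [s X] is [Some q] when [X] belongs to a fixpoint already unfolded at time 0, and [None] when [X]
    is bound within the shifted formula. *)
Fixpoint shift s p : mf AP E :=
  match p with
  | MAtom d pi => MAtom E (h d pi) pi
  | MVar X => if s X is Some q then q else MVar AP E X
  | MOr p1 p2 => MOr (shift s p1) (shift s p2)
  | MNot p1 => MNot (shift s p1)
  | MNext _ p1 => MNext E0 (shift s p1)
  | MMu X p1 => MMu X (shift (upd_sub s X None) p1)
  end.

(* The value at time 0 of a formula, as a formula about the run shifted by one;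
   s gives the shifted unfoldings of the enclosing fixpoints, whose variables are
   false at time 0 itself. *)
Fixpoint start s p : mf AP E :=
  match p with
  | MAtom d pi => MAtom E d pi
  | MVar X => mFalse E
  | MOr p1 p2 => MOr (start s p1) (start s p2)
  | MNot p1 => MNot (start s p1)
  | MNext _ p1 => shift s p1
  | MMu X p1 => start (upd_sub s X (Some (shift s p))) p1
  end.

(** Substituted formulae must have the right value under every valuation [V''], which excludes
    capture under binders. *)
Lemma lsem_shift A B s V V' p :
  mall_atom (fun d pi => forall k, A d pi k.+1 <-> B (h d pi) pi k) p ->
  (forall X, match s X with
             | Some q => forall V'' k, lsem B V'' q k <-> V X k.+1
             | None => forall k, V' X k <-> V X k.+1
             end) ->
  forall k, lsem B V' (shift s p) k <-> lsem A V p k.+1.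
Proof.
elim: p s V V' => [d pi|X|p IHp q IHq|p IHp|F p IHp|X p IHp] s V V' eqAB eqV k //=.
- by rewrite eqAB.
- by have := eqV X; case: (s X) => /=.
- by rewrite (IHp s V V') ?(IHq s V V') //; case: eqAB.
- by rewrite (IHp s V V').
- exact: IHp.
have eqS (S S' : nat -> Prop) : (forall k, S' k <-> S k.+1) -> forall k,
    lsem B (updV V' X S') (shift (upd_sub s X None) p) k <->
    lsem A (updV V X S) p k.+1.
  move=> eqSS; apply: IHp => // Y; rewrite /upd_sub /updV.
  by case: eqP => // _; apply: eqV.
split=> fixS S closedS.
  by apply: (fixS (fun k => S k.+1)) => u /(eqS S) /closedS; apply.
(* Time 0 is filled with [True], so closedness has to be checked at positive times only. *)
pose S1 k := if k is k'.+1 then S k' else True.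
by apply: (fixS S1) => -[//|u] /(eqS S1 S) pu; apply: closedS; apply: pu.
Qed.

Lemma lsem_start dok tv b A B s V V' p : mok dok tv b p ->
  mall_atom (fun d pi => forall k, A d pi k.+1 <-> B (h d pi) pi k) p ->
  mall_atom (fun d pi => A d pi 0 <-> B d pi 0) p ->
  (forall X, exists q, s X = Some q /\ forall V'' k, lsem B V'' q k <-> V X k.+1) ->
  (forall X, ~ V X 0) ->
  lsem B V' (start s p) 0 <-> lsem A V p 0.
Proof.
elim: p b s V V' => [d pi|X|p IHp q IHq|p IHp|F p IHp|X p IHp] b s V V' okp eqS eq0 eqV nV0.
- by rewrite /= (eq0 : A d pi 0 <-> _).
- by rewrite /start lsem_False; split=> // /nV0.
- case: okp eqS eq0 => okp okq [eqSp eqSq] [eq0p eq0q] /=.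
  by rewrite (IHp b s V V') // (IHq b s V V').
- by rewrite /= (IHp b s V V').
- rewrite /=; apply: lsem_shift => // Y.
  by have [q [-> eqq]] := eqV Y.
case: okp => posp okp; rewrite lsem_mu0 // [start _ _]/=.
apply: (IHp _ _ _ _ okp eqS eq0) => Y; last first.
  by rewrite /updV; case: eqP => // _ [].
rewrite /upd_sub /updV; case: eqP => [_|_]; last exact: eqV.
exists (shift s (MMu X p)); split=> // V'' k.
have -> : lsem B V'' (shift s (MMu X p)) k <-> lsem A V (MMu X p) k.+1.
  by apply: lsem_shift => // Z; have [q [-> eqq]] := eqV Z.
by split=> [|[]].
Qed.

Hypothesis tok_h : forall d pi, tok d -> tok (h d pi).
Let ok tv := mok (AP := AP) (D := E) (fun _ E' => E' = E0) tv.

Lemma mpos_shift dok tv b X s p : (forall Y q, s Y = Some q -> mok dok tv [::] q) ->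
  mpos b X p -> mpos b X (shift s p).
Proof.
elim: p b s => [d pi|Y|p IHp q IHq|p IHp|F p IHp|Y p IHp] b s oks //=.
- by case sY: (s Y) => [q|//] _; apply: mpos_notin (oks _ _ sY) _.
- by case/andP=> /IHp-> // /IHq->.
- exact: IHp.
- exact: IHp.
case/orP=> [->//|posp]; rewrite IHp ?orbT // => Z q.
by rewrite /upd_sub; case: eqP => // _; apply: oks.
Qed.

Lemma mok_shift dok tv b b' s p : mok dok tv b p ->
  (forall Y, Y \in b -> s Y = None -> Y \in b') ->
  (forall Y q, s Y = Some q -> ok tv [::] q) ->
  ok tv b' (shift s p).
Proof.
rewrite /ok; elim: p b b' s => [d pi|Y|p IHp q IHq|p IHp|F p IHp|Y p IHp] b b' s //=.
- by case=> /tok_h okd pitv _ _; split.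
- move=> Yb sub oks; have := sub _ Yb.
  by case sY: (s Y) => [q|]; [move=> _; apply/mok_weak/oks/sY|apply].
- by case=> okp okq sub oks; split; [apply: IHp okp _ _|apply: IHq okq _ _].
- exact: IHp.
- by case=> _ okp sub oks; split=> //; apply: IHp okp _ _.
case=> posp okp sub oks.
have oks' Z q : upd_sub s Y None Z = Some q -> ok tv [::] q.
  by rewrite /upd_sub; case: eqP => // _; apply: oks.
split; first exact: mpos_shift oks' posp.
apply: IHp okp _ oks' => Z; rewrite /upd_sub !inE; case: eqP => //= _.
exact: sub.
Qed.

Lemma mok_start dok tv b b' s p : mok dok tv b p ->
  (forall Y, exists q, s Y = Some q /\ ok tv [::] q) -> ok tv b' (start s p).
Proof.
elim: p b b' s => [d pi|Y|p IHp q IHq|p IHp|F p IHp|Y p IHp] b b' s.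
- by [].
- by rewrite /ok /= inE.
- by case=> okp okq oks; split; [apply: IHp okp oks|apply: IHq okq oks].
- exact: IHp.
- case=> _ okp oks; apply: mok_shift okp _ _ => Y; have [q [sY okq]] := oks Y.
    by rewrite sY.
  by move=> q'; rewrite sY => -[<-].
move=> [posp okp] oks; apply: (IHp _ _ _ okp) => Z; rewrite /upd_sub.
case: eqP => [_|_]; last exact: oks.
exists (shift s (MMu Y p)); split=> //.
apply: (@mok_shift dok tv b) => [|Z'|Z' q]; first by split.
  by have [q [->]] := oks Z'.
by have [q' [-> okq]] := oks Z' => -[<-].
Qed.

End Shift.

(** * Case distinction at time 0 *)

Section Cases.
Variable E : Type.
Variables (c : nat -> tf AP) (F : (nat -> bool) -> mf AP E).

Fixpoint mcases (tv : seq nat) (b : nat -> bool) : mf AP E :=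
  if tv is pi :: tv' then
    MOr (mAnd (MAtom E (c pi) pi) (mcases tv' (fun q => (q == pi) || b q)))
        (mAnd (MNot (MAtom E (c pi) pi))
              (mcases tv' (fun q => (q != pi) && b q)))
  else F b.

(** The clause on variables outside [tv] carries earlier outcomes through the recursion; [uniq tv]
    keeps them from being overwritten. *)
Lemma mcasesE (B : tf AP -> nat -> nat -> Prop) V (tv : seq nat)
  (b : nat -> bool) k : uniq tv ->
  exists b' : nat -> bool, [/\ forall pi, pi \in tv -> b' pi <-> B (c pi) pi k,
                 forall pi, pi \notin tv -> b' pi = b pi &
                 lsem B V (mcases tv b) k <-> lsem B V (F b') k].
Proof.
elim: tv b => [|pi tv IHtv] b /=; first by exists b.
case/andP=> npi /IHtv{}IHtv.
have [Bpi|nBpi] := classic (B (c pi) pi k).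
  have [b' [b'in b'out eqb']] := IHtv (fun q => (q == pi) || b q).
  exists b'; split=> [q|q|].
  - by rewrite inE; case/orP=> [/eqP->|/b'in//]; rewrite b'out // eqxx.
  - by rewrite inE negb_or => /andP[/negPf neq /b'out->]; rewrite neq.
  - by rewrite -eqb' -/(lsem _ _ _ _); tauto.
have [b' [b'in b'out eqb']] := IHtv (fun q => (q != pi) && b q).
exists b'; split=> [q|q|].
- by rewrite inE; case/orP=> [/eqP->|/b'in//]; rewrite b'out // eqxx.
- by rewrite inE negb_or => /andP[neq /b'out->]; rewrite neq.
- by rewrite -eqb' -/(lsem _ _ _ _); tauto.
Qed.

Lemma mok_mcases dok (tv tv' : seq nat) b : {subset tv' <= tv} ->
  (forall pi, pi \in tv -> tok (c pi)) -> (forall b, mok dok tv [::] (F b)) ->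
  mok dok tv [::] (mcases tv' b).
Proof.
move=> + okc okF; elim: tv' b => [|pi tv' IHtv] b sub //=.
have pitv : pi \in tv by apply: sub; rewrite mem_head.
have sub' : {subset tv' <= tv} by move=> q q_tv; apply: sub; rewrite inE q_tv orbT.
by do !split; rewrite ?okc //; apply: IHtv.
Qed.

End Cases.

(** * From position vectors to times along a run *)

Section Runs.
Variables (D : Type) (step : D -> nat -> trace AP -> nat -> nat -> Prop).
Variables (R : nat -> trace AP -> nat -> nat -> Prop).

Definition steps_as (tv : seq nat) (Dl : D) : Prop :=
  forall pi, pi \in tv -> forall tr i j,
    step Dl pi tr i j <-> first_or (R pi tr i) i j.

Variables (Pi : nat -> option (trace AP)) (tv : seq nat).
Hypothesis dom_Pi : forall pi tr, Pi pi = Some tr -> pi \in tv.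

Definition run (k pi : nat) : nat :=
  if Pi pi is Some tr then pos (R pi tr) k else k.

Definition run_atom (d : tf AP) (pi k : nat) : Prop :=
  if Pi pi is Some tr then tsem tr V0 d (pos (R pi tr) k) else False.

Lemma pos_lt (Q : nat -> nat -> Prop) : {homo pos Q : k l / k < l}.
Proof.
apply: homo_ltn => [? ? ?|k]; first exact: ltn_trans.
have : first_or (Q (pos Q k)) (pos Q k) (pos Q k.+1) by apply/first_orP.
by case=> [[]|[_ ->]].
Qed.

Lemma run_inj : injective run.
Proof.
(* Component 0 suffices: bound or not, it increases strictly with time. *)
move=> k l /(congr1 (fun v => v 0)); rewrite /run; case: (Pi 0) => [tr|//] eqkl.
by case: (ltngtP k l) => // /(@pos_lt (R 0 tr)); rewrite eqkl ltnn.
Qed.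

Lemma nextvec_run Dl k w : steps_as tv Dl ->
  nextvec step Dl Pi (run k) w <-> w = run k.+1.
Proof.
move=> stepD; rewrite /nextvec /run; split=> [next|-> pi].
  apply: functional_extensionality => pi; have := next pi.
  case Pi_pi: (Pi pi) => [tr|//].
  by rewrite (stepD pi (dom_Pi Pi_pi)) => /first_orP.
case Pi_pi: (Pi pi) => [tr|//].
by apply/(stepD pi (dom_Pi Pi_pi))/first_orP.
Qed.

Lemma msem_run W V (p : mf AP D) k : mall_next steps_as tv p ->
  (forall X k, W X (run k) <-> V X k) ->
  msem step Pi W p (run k) <-> lsem run_atom V p k.
Proof.
elim: p W V k => [d pi|X|p IHp q IHq|p IHp|Dl p IHp|X p IHp] W V k allp eqW //=.
- by rewrite /run_atom /run; case: (Pi pi).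
- by rewrite (IHp W V) ?(IHq W V) //; case: allp.
- by rewrite (IHp W V).
- case: allp => stepD allp; rewrite -(IHp W V) //; split.
    by case=> w [/(nextvec_run _ _ stepD)->].
  by exists (run k.+1); split=> //; apply/nextvec_run.
split=> fixS S closedS.
  (* A set of times becomes a set of vectors that contains every vector off the run; [run_inj]
     recovers the time of a visited vector. *)
  apply: (fixS (fun v => forall l, v = run l -> S l)) => // u pu l def_u.
  apply: closedS; rewrite def_u in pu; move: pu.
  apply: (IHp _ _ _ allp _).1 => Y j; rewrite /updW /updV; case: eqP => // _.
  by split=> [/(_ j)|Sj j' /run_inj<-]; first apply.
apply: (fixS (fun j => S (run j))) => u pu; apply: closedS; move: pu.
by apply: (IHp _ _ _ allp _).2 => Y j; rewrite /updW /updV; case: eqP.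
Qed.

End Runs.
End LinearTime.

(** * Translations of hyperproperty formulae *)

Section Translation.
Variable AP : finType.

Lemma mall_next_sub (D : Type) (dok P P' : seq nat -> D -> Prop) tv b
  (p : mf AP D) : mok dok tv b p -> mall_next P tv p ->
  (forall Dl, dok tv Dl -> P tv Dl -> P' tv Dl) -> mall_next P' tv p.
Proof.
move=> + + PP'; elim: p b => [d pi|X|p IHp q IHq|p IHp|Dl p IHp|X p IHp] b //=.
- by case=> okp okq [Pp Pq]; split; [apply: IHp okp Pp|apply: IHq okq Pq].
- exact: IHp.
- by case=> okD okp [PD Pp]; split; [apply: PP'|apply: IHp okp Pp].
- by case=> _; apply: IHp.
Qed.

Section Prefix.
Variables (D E : Type).
Variables (stepD : D -> nat -> trace AP -> nat -> nat -> Prop).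
Variables (stepE : E -> nat -> trace AP -> nat -> nat -> Prop).

Definition bound_in (tv : seq nat) (Pi : nat -> option (trace AP)) : Prop :=
  forall pi tr, Pi pi = Some tr -> pi \in tv.

Lemma bound_in_upd tv Pi pi tr : bound_in tv Pi -> bound_in (pi :: tv) (updPi Pi pi tr).
Proof.
move=> bPi q tr'; rewrite /updPi inE; case: eqP => //= _; exact: bPi.
Qed.

Definition equiv_at0 (tv : seq nat) (p : mf AP D) (p' : mf AP E) : Prop :=
  forall Pi, bound_in tv Pi ->
    msem stepD Pi W0 p (fun _ => 0) <-> msem stepE Pi W0 p' (fun _ => 0).

(** Common core of both directions: [c] is the test made at time 0 on each trace, and [h] translates
    an atom according to its outcome. *)
Lemma shift_formula RD RE dok tv p (E0 : E) (c : nat -> tf AP)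
  (h : bool -> nat -> tf AP -> tf AP) :
  mok dok tv [::] p -> mall_next (steps_as stepD RD) tv p ->
  steps_as stepE RE tv E0 ->
  (forall pi, tok (c pi)) -> (forall b pi d, tok d -> tok (h b pi d)) ->
  (forall pi d tr (b : bool), List.In d (matoms p) -> tok d -> pi \in tv ->
     b <-> tsem tr V0 (c pi) 0 -> forall k,
     tsem tr V0 d (pos (RD pi tr) k.+1) <->
     tsem tr V0 (h b pi d) (pos (RE pi tr) k)) ->
  exists p', mok (fun _ E' => E' = E0) tv [::] p' /\ equiv_at0 tv p p'.
Proof.
move=> okp nextp stepE0 okc okh eq_h.
(* [p] has no free variables; [mFalse] agrees with the valuation [V0] at all times. *)
pose s (X : nat) := Some (mFalse AP E).
pose F b := start (fun d pi => h (b pi) pi d) E0 s p.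
pose p' := mcases c F (undup tv) (fun _ => false).
have okp' : mok (fun _ E' => E' = E0) tv [::] p'.
  apply: mok_mcases => [pi|//|b]; first by rewrite mem_undup.
  by apply: mok_start okp _ => [d pi|Y]; [apply: okh|exists (mFalse AP E)].
exists p'; split=> // Pi bPi.
have run0 (R : nat -> trace AP -> nat -> nat -> Prop) : (fun _ : nat => 0) = run R Pi 0.
  by apply: functional_extensionality => pi; rewrite /run; case: (Pi pi).
rewrite {1}(run0 RD) (run0 RE) (msem_run bPi (V := V0)) //.
rewrite (msem_run (R := RE) bPi (V := V0)) //; last first.
  by have [] := mok_const (dok := fun _ _ => True) okp' I stepE0.
have [b [b_in _ ->]] :=
  mcasesE c F (run_atom RE Pi) V0 (fun _ => false) 0 (undup_uniq tv).
apply: iff_sym; apply: (lsem_start (h := fun d pi => h (b pi) pi d) E0 V0 okp) => [||X|X []].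
- apply: (mok_atoms okp) => d pi dp okd pitv k; rewrite /run_atom.
  have := b_in pi; rewrite mem_undup /run_atom => /(_ pitv).
  by case: (Pi pi) => // tr /eq_h; apply.
- by apply: (mok_atoms okp) => d pi _ _ _; rewrite /run_atom; case: (Pi pi).
by exists (mFalse AP E); split=> // V'' k; apply: lsem_False.
Qed.

(** The quantifier prefix is kept. The annotation [E0] is chosen below it, where the scope [tv] and
    the atoms of the matrix are known. *)
Lemma prefix_lift dokD dokE PD (PE : E -> seq nat -> E -> Prop) :
  (forall E0 tv, PE E0 tv E0) ->
  (forall tv p, mok dokD tv [::] p -> mall_next PD tv p ->
     exists E0, dokE tv E0 /\
     exists p', mok (fun _ E' => E' = E0) tv [::] p' /\ equiv_at0 tv p p') ->
  forall f tv, hok dokD tv f -> hall_next PD tv f ->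
  exists g, [/\ hok dokE tv g, exists E0, hall_next (PE E0) tv g &
    forall T Pi, bound_in tv Pi -> hsem stepD T Pi f <-> hsem stepE T Pi g].
Proof.
move=> PErefl liftm; elim=> [pi f IHf|pi f IHf|p] tv /=.
- move=> okf nf; have [g [okg ng eqg]] := IHf _ okf nf.
  exists (HEx pi g); split=> // T Pi bPi /=.
  have eqtr tr := eqg T _ (@bound_in_upd _ _ pi tr bPi).
  by split=> -[tr [Ttr /eqtr sem]]; exists tr.
- move=> okf nf; have [g [okg ng eqg]] := IHf _ okf nf.
  exists (HAll pi g); split=> // T Pi bPi /=.
  have eqtr tr := eqg T _ (@bound_in_upd _ _ pi tr bPi).
  by split=> sem tr /sem /eqtr.
move=> okp np; have [E0 [okE [p' [okp' eqp]]]] := liftm _ _ okp np.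
have [okp'' np''] := mok_const okp' okE (PErefl E0 tv).
by exists (HM p'); split=> //; exists E0.
Qed.

End Prefix.

Lemma mumble_to_stutter (Dl0 : mumD AP) tv p :
  mok (@mum_dok AP) tv [::] p ->
  mall_next (fun tv Dl => forall pi, pi \in tv -> Dl pi = Dl0 pi) tv p ->
  exists G, stu_dok tv G /\
  exists p', mok (fun _ G' => G' = G) tv [::] p' /\
             equiv_at0 (@mum_step AP) (@stu_step AP) tv p p'.
Proof.
move=> okp nextp.
(* [Dl0] is constrained only through annotations that occur, so its ill-formed entries are replaced
   by a closed formula. *)
pose Dl1 pi := if tok (Dl0 pi) then Dl0 pi else tFalse AP.
have okDl pi : tok (Dl1 pi) by rewrite /Dl1; case: ifP.
have okL e : List.In e (matoms p) -> tok e by apply: mok_tok okp.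
exists (fun pi => stutter_basis (Dl1 pi) (matoms p)); split.
  by move=> pi _ d; apply: tok_stutter_basis.
apply: (@shift_formula _ _ _ _ (fun pi tr _ => tsem tr V0 (Dl1 pi))
  (fun pi tr => changes (stutter_basis (Dl1 pi) (matoms p)) tr)
  _ tv p _ (fun pi => tstar (Dl1 pi))
  (fun b pi d => stutter_atom b (Dl1 pi) d) okp) => //.
- apply: mall_next_sub okp nextp _ => Dl okD eqD pi pitv tr i j.
  by rewrite /mum_step (eqD pi pitv) /Dl1 -(eqD pi pitv) okD.
- by move=> pi; apply: tok_star.
- by move=> b pi d okd; case: b; rewrite /stutter_atom; do ?apply: tok_tN.
move=> pi d tr b Ld okd pitv b0 k; exact: mumble_atom_stutter.
Qed.

Lemma stutter_to_mumble (G0 : stuD AP) tv p :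
  mok (@stu_dok AP) tv [::] p ->
  mall_next (fun tv G => forall pi, pi \in tv ->
    forall d, List.In d (G pi) <-> List.In d (G0 pi)) tv p ->
  exists Dl, mum_dok tv Dl /\
  exists p', mok (fun _ Dl' => Dl' = Dl) tv [::] p' /\
             equiv_at0 (@stu_step AP) (@mum_step AP) tv p p'.
Proof.
move=> okp nextp.
(* Likewise, formulae of [G0] that are not closed and well-formed are discarded; none of them lies
   in an occurring annotation. *)
pose G1 pi := List.filter (@tok AP) (G0 pi).
have okG pi e : List.In e (G1 pi) -> tok e by case/List.filter_In.
exists (fun pi => block_end (G1 pi)); split.
  by move=> pi _; apply/tok_block_end/okG.
apply: (@shift_formula _ _ _ _ (fun pi tr => changes (G1 pi) tr)
  (fun pi tr _ => tsem tr V0 (block_end (G1 pi)))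
  _ tv p _ (fun pi => tstar (block_end (G1 pi)))
  (fun b pi d => mumble_atom b (G1 pi) d) okp) => //.
- apply: mall_next_sub okp nextp _ => G okGp eqG pi pitv tr i j.
  apply: first_or_ext => k; rewrite /changes.
  have inG d : List.In d (G pi) <-> List.In d (G1 pi).
    rewrite /G1 List.filter_In -(eqG pi pitv).
    by split=> [Gd|[]//]; split=> //; apply: okGp Gd.
  by split=> -[d [/inG Gd ne]]; exists d.
- by move=> pi; apply/tok_star/tok_block_end/okG.
- move=> b pi d okd; case: b => //; rewrite /mumble_atom.
  by apply: tok_tQ => //; apply/tok_block_end/okG.
by move=> pi d tr b Ld okd pitv b0 k; apply: stutter_atom_mumble => //; apply: okG.
Qed.

End Translation.

Theorem theorem6p6 (AP : finType) :
  (forall f : hf AP (mumD AP), mum_unique_closed f ->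
     exists g : hf AP (stuD AP), stu_unique_closed g /\
       forall T : trace AP -> Prop, mum_models T f <-> stu_models T g) /\
  (forall g : hf AP (stuD AP), stu_unique_closed g ->
     exists f : hf AP (mumD AP), mum_unique_closed f /\
       forall T : trace AP -> Prop, mum_models T f <-> stu_models T g).
Proof.
split=> f [okf [D0 nextf]].
  have [g [okg [E0 nextg] eqg]] :=
    prefix_lift (dokE := @stu_dok AP) (PE := fun G0 tv G => forall pi, pi \in tv ->
      forall d, List.In d (G pi) <-> List.In d (G0 pi))
      (fun _ _ _ _ _ => iff_refl _) (@mumble_to_stutter AP D0) okf nextf.
  by exists g; split=> [|T]; [split=> //; exists E0|apply: eqg].
have [g [okg [E0 nextg] eqg]] :=
  prefix_lift (dokE := @mum_dok AP) (PE := fun Dl0 tv Dl => forall pi, pi \in tv ->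
    Dl pi = Dl0 pi) (fun _ _ _ _ => erefl) (@stutter_to_mumble AP D0) okf nextf.
by exists g; split=> [|T]; [split=> //; exists E0|symmetry; apply: eqg].
Qed.
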